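(* For every $\varepsilon>0$ there exists $\delta>0$ such that the following holds. Let $G$ be a connected graph on vertex set $[n]$ with maximum degree $\Delta$, let $R\sim G(n,\varepsilon/n)$, and let $G^*=G\cup R$. Then asymptotically almost surely (i.e., with probability tending to $1$ as $n\to\infty$) the graph $G^*$ satisfies $\iota(G^* )\ge \frac{\delta}{\Delta^3\log n}$.
   Context: $G(n,p)$ denotes the binomial random graph on vertex set $[n]$ in which each of the $\binom n2$ pairs is an edge independently with probability $p$. $G\cup R$ is the graph on $[n]$ whose edge set is the union of the edge sets of $G$ and $R$. For a graph $H$ on vertex set $V$ and $S\subseteq V$, $N_H(S)$ is the set of vertices in $V\setminus S$ having a neighbor in $S$. The vertex-isoperimetric number is $\iota(H)=\min\{|N_H(U)|/|U| : U\subseteq V,\ 0<|U|\le |V|/2\}$. ''Asymptotically almost surely'' is understood for an arbitrary sequence of such graphs $G=G_n$, with $n\to\infty$. *)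

(* Defs.v *)
From Stdlib Require Import Reals.
From mathcomp Require Import all_boot.

Set Implicit Arguments.
Unset Strict Implicit.
Unset Printing Implicit Defensive.

(* A (simple) graph on vertex set [n] is given by an edge set of ordered
   pairs; the adjacency is its symmetrisation with loops removed. *)
Definition graph (n : nat) := {set 'I_n * 'I_n}.

Definition gadj n (E : graph n) : rel 'I_n :=
  fun u v => (u != v) && (((u, v) \in E) || ((v, u) \in E)).

Definition gunion n (E F : graph n) : graph n := E :|: F.

Definition gconnected n (E : graph n) : bool :=
  [forall u, forall v, connect (gadj E) u v].

Definition gdeg n (E : graph n) (v : 'I_n) : nat := #|[set u | gadj E v u]|.
Definition maxdeg n (E : graph n) : nat := \max_(v : 'I_n) gdeg E v.

Definition nbhd n (E : graph n) (S : {set 'I_n}) : {set 'I_n} :=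
  [set v | (v \notin S) && [exists u in S, gadj E u v]].

(* vertex-isoperimetric number: minimum of |N(U)|/|U| over 0<|U|<=n/2.
   The index INR n of the Rmin-fold is only a dummy value for the empty
   range (n <= 1); for n >= 2 every ratio is < n, so it is never attained. *)
Definition vert_iso n (E : graph n) : R :=
  \big[Rmin/INR n]_(U : {set 'I_n} | (0 < #|U|)%N && (2 * #|U| <= n)%N)
     (Rdiv (INR #|nbhd E U|) (INR #|U|)).

Definition upairs n : {set 'I_n * 'I_n} := [set e : 'I_n * 'I_n | (e.1 < e.2)%N].

Definition gnp_prob n (p : R) (A : graph n -> bool) : R :=
  \big[Rplus/R0]_(S : {set 'I_n * 'I_n} | (S \subset upairs n) && A S)
     (Rmult (pow p #|S|) (pow (Rminus R1 p) (#|upairs n| - #|S|))).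

Definition Rleb (x y : R) : bool := if Rle_dec x y then true else false.

(* Main.v *)
(* Let G* = G ∪ R, let U violate the isoperimetric bound, and put W = N_{G*}(U).
   No edge of R joins U to the complement of U ∪ W, which for fixed (U, W) has
   probability at most (1 - p)^(|U| (n - |U| - |W|)) <= exp(- eps |U| / 4).
   Since G is connected, U is recovered from W and its trace T on N_G(W), and
   |N_G(W)| <= Delta |W|; so each W is paired with at most 2^(Delta |W|) sets U.
   With delta = eps / 12, |W| < delta |U| / (Delta^3 log n) makes each
   probability at most n^(-3 Delta |W|), and the union bound is at most the sum
   of n^(-2|W|) over nonempty W, which is (1 + n^-2)^n - 1 = O(1/n). *)
From Stdlib Require Import Reals Lra.
From mathcomp Require Import all_boot all_order all_algebra.
From mathcomp Require Import Rstruct.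
(* Required last: [Rstruct] also defines a boolean comparison [Rleb]. *)
Require Import Defs.

Set Implicit Arguments.
Unset Strict Implicit.
Unset Printing Implicit Defensive.

Import Order.TTheory GRing.Theory Num.Theory.

(** * Binomial sums over subsets and the union bound *)

Section FiniteSums.
Local Open Scope ring_scope.

(** Grouping the subsets by cardinality gives the binomial theorem. The case [x + y = 1] is the
    total mass of a random subset. *)
Lemma sum_subset_exp (K : comNzRingType) (T : finType) (A : {set T}) (x y : K) :
  \sum_(S : {set T} | S \subset A) x ^+ #|S| * y ^+ (#|A| - #|S|)
  = (x + y) ^+ #|A|.
Proof.
rewrite addrC exprDn.
rewrite (partition_big (fun S : {set T} => inord #|S| : 'I_#|A|.+1) xpredT) //=.
apply: eq_bigr => i _.
rewrite -cards_draws -sumr_const.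
apply: eq_big => [S | S /andP[SA /eqP <-]].
  rewrite !inE; case SA: (S \subset A) => //=.
  by rewrite -val_eqE /= inordK // ltnS subset_leq_card.
by rewrite inordK ?ltnS ?subset_leq_card // mulrC.
Qed.

(** The subsets avoiding [D] are those of [A :\: D]; once [(1 - p) ^+ #|D|] is factored out, their
    weights sum to 1. *)
Lemma sum_subset_avoid (K : comNzRingType) (T : finType) (A D : {set T}) (p : K) :
  D \subset A ->
  \sum_(S : {set T} | (S \subset A) && [disjoint S & D])
     p ^+ #|S| * (1 - p) ^+ (#|A| - #|S|) = (1 - p) ^+ #|D|.
Proof.
move=> DA.
have cA : #|A| = (#|A :\: D| + #|D|)%N.
  by rewrite -(cardsID D A) addnC (setIidPr DA).
have := sum_subset_exp (A :\: D) p (1 - p).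
rewrite [p + _]addrC subrK expr1n => h.
rewrite -[RHS]mul1r -[X in X * _]h mulr_suml.
apply: eq_big => [S | S /andP[SA dSD]]; first by rewrite subsetD.
have SAD : S \subset A :\: D by rewrite subsetD SA.
rewrite -[RHS]mulrA -exprD; congr (_ * _ ^+ _).
by rewrite cA addnBAC // subset_leq_card.
Qed.

(** After exchanging the sums, [f j] is counted once for each [i] with [E i j], hence at least once
    when [B j]. *)
Lemma sum_union_bound (K : numDomainType) (I J : finType) (B : pred J)
    (P : pred I) (E : I -> pred J) (f : J -> K) :
  (forall i j, E i j -> 0 <= f j) ->
  (forall j, B j -> exists2 i, P i & E i j) ->
  \sum_(j | B j) f j <= \sum_(i | P i) \sum_(j | E i j) f j.
Proof.
move=> fE h.
rewrite (exchange_big_dep xpredT) //= big_mkcond /=.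
apply: ler_sum => j _; case: ifP => Bj; last first.
  by apply: sumr_ge0 => i /andP[_ /fE].
have [i Pi Ei] := h j Bj.
rewrite (bigD1 i) ?Pi //= lerDl; apply: sumr_ge0 => k.
by case/andP => /andP[_ /fE].
Qed.

End FiniteSums.

(** * Vertex boundaries, separators and crossing pairs *)

Section Separation.
Variables (n : nat).
Implicit Types (E G S : graph n) (U W T : {set 'I_n}).

Lemma gadj_sym G : symmetric (gadj G).
Proof. by move=> u v; rewrite /gadj eq_sym orbC. Qed.

Lemma gadj_unionl G S u v : gadj G u v -> gadj (gunion G S) u v.
Proof.
by case/andP=> uv /orP[] h; rewrite /gadj /gunion uv !inE h ?orbT.
Qed.

Lemma gadj_unionr G S u v : gadj S u v -> gadj (gunion G S) u v.
Proof.
by case/andP=> uv /orP[] h; rewrite /gadj /gunion uv !inE h ?orbT.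
Qed.

(** With an empty neighbourhood [U] would be closed under adjacency, so connectedness would spread
    it to every vertex. *)
Lemma nbhd_neq0 G U : gconnected G -> U != set0 -> U != setT -> nbhd G U != set0.
Proof.
move=> /forallP cG /set0Pn[u uU] UT.
have /subsetPn [v _ vU] : ~~ (setT \subset U) by rewrite subTset.
apply/eqP => N0.
have clU : closed (gadj G) U.
  apply: intro_closed => [x y | x y xy xU];
    first exact/sym_connect_sym/gadj_sym.
  apply: contraT => yU; have : y \in nbhd G U; last by rewrite N0 inE.
  by rewrite inE yU; apply/existsP; exists x; rewrite xU.
have /forallP/(_ v) uv := cG u.
by have := closed_connect clU uv; rewrite uU (negbTE vU).
Qed.

Lemma nbhdU G S U : nbhd G U \subset nbhd (gunion G S) U.
Proof.
apply/subsetP => v; rewrite !inE => /andP[-> /existsP[u /andP[uU uv]]].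
by apply/existsP; exists u; rewrite uU gadj_unionl.
Qed.

Lemma card_nbhd_le G W : #|nbhd G W| <= maxdeg G * #|W|.
Proof.
have sub : nbhd G W \subset cover [set [set u | gadj G w u] | w in W].
  apply/subsetP => v; rewrite inE => /andP[_ /existsP[w /andP[wW wv]]].
  by apply/bigcupP; exists [set u | gadj G w u]; rewrite ?imset_f ?inE.
apply: leq_trans (subset_leq_card sub) _.
rewrite cover_imset mulnC -sum_nat_const.
elim/big_rec2: _ => [|w m A _ IH]; first by rewrite cards0.
apply: leq_trans (leq_card_setU _ _) (leq_add _ IH).
exact: (leq_bigmax (F := gdeg G)).
Qed.

Lemma maxdeg_gt0 G : 1 < n -> gconnected G -> 0 < maxdeg G.
Proof.
move=> n1 cG; pose v : 'I_n := Ordinal (ltnW n1).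
have : nbhd G [set v] != set0.
  apply: nbhd_neq0 => //; first by apply/set0Pn; exists v; rewrite inE.
  apply/eqP => /(congr1 (fun A : {set _} => #|A|)); rewrite cards1 cardsT card_ord => e.
  by have := n1; rewrite -e.
rewrite -card_gt0 => h; have := leq_trans h (card_nbhd_le G [set v]).
by rewrite cards1 muln1.
Qed.

(** For [T] outside [W], this is the union of the components of [G - W] that meet [T]; the relation
    tests only the head of each step. *)
Definition cut_closure G W T : {set 'I_n} :=
  [set v | [exists t in T, connect [rel a b | gadj G a b && (b \notin W)] t v]].

(* Every component of [G - W] has a vertex adjacent to [W], so a union of
   components is determined by its trace on the neighbourhood of [W]. *)
Lemma cut_closure_trace G U W : gconnected G -> W != set0 ->
  nbhd G U \subset W -> [disjoint U & W] -> cut_closure G W (U :&: nbhd G W) = U.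
Proof.
move=> cG W0 /subsetP NW dUW; set C := cut_closure _ _ _.
have UW u : u \in U -> u \notin W by move/(disjointFr dUW)->.
have stepU u v : u \in U -> gadj G u v -> v \notin W -> v \in U.
  move=> uU uv; apply: contraNT => vU; apply: NW.
  by rewrite inE vU; apply/existsP; exists u; rewrite uU.
have CU : C \subset U.
  apply/subsetP => v; rewrite inE => /existsP[t /andP[]].
  rewrite inE => /andP[tU _] /connectP[q qp ->] {v}.
  elim: q t tU qp => [|x q IH] t tU //= /andP[/andP[tx xW]].
  by apply: IH; apply: stepU tx xW.
apply/eqP; rewrite eqEsubset CU /= -setD_eq0; apply: contraT => A0.
have AT : U :\: C != setT.
  have /set0Pn[w wW] := W0.
  apply/eqP => /setP /(_ w); rewrite !inE => /andP[_ wU].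
  by have := UW _ wU; rewrite wW.
(* Take an edge [ab] leaving the missed part [U :\: C] at [a]. If [b] is in [W], then [a] is in the
   trace; otherwise [b] is in [U], hence in [C], and [C] reaches [a]. *)
have /set0Pn[b] := nbhd_neq0 cG A0 AT.
rewrite inE => /andP[bA /existsP[a /andP[]]].
rewrite inE => /andP[aC aU] ab.
case bW: (b \in W).
  case/negP: aC; rewrite inE; apply/existsP; exists a; rewrite connect0 andbT.
  rewrite inE aU inE UW //=; apply/existsP; exists b; rewrite bW.
  by rewrite gadj_sym.
have bU : b \in U by apply: stepU ab _; rewrite ?bW.
move: bA; rewrite inE bU andbT negbK => bC; case/negP: aC.
move: bC; rewrite !inE => /existsP[t /andP[tT tb]].
apply/existsP; exists t; rewrite tT; apply: connect_trans tb (connect1 _).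
by rewrite /= gadj_sym ab UW.
Qed.

(** Elements of [upairs] have their smaller endpoint first, so either coordinate may be the one in
    [U]. *)
Definition cross_pairs (U X : {set 'I_n}) : {set 'I_n * 'I_n} :=
  [set e in upairs n | (e.1 \in U) && (e.2 \in X) || (e.1 \in X) && (e.2 \in U)].

(** Sorting the endpoints maps [setX U X] into the crossing pairs; disjointness tells which endpoint
    came from [U], so the map is injective. *)
Lemma card_cross_pairs_ge (U X : {set 'I_n}) : [disjoint U & X] ->
  #|U| * #|X| <= #|cross_pairs U X|.
Proof.
move=> dUX; rewrite -cardsX.
pose f (e : 'I_n * 'I_n) := if e.1 < e.2 then e else (e.2, e.1).
have inj : {in setX U X &, injective f}.
  move=> [u x] [u' x']; rewrite !inE /f /= => /andP[uU xX] /andP[uU' xX'].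
  case: ifP => _; case: ifP => _ [] e1 e2; first by rewrite e1 e2.
  - by have := disjointFr dUX uU; rewrite e1 xX'.
  - by have := disjointFr dUX uU'; rewrite -e1 xX.
  - by rewrite e1 e2.
rewrite -(card_in_imset inj); apply/subset_leq_card/subsetP => e /imsetP[[u x]].
rewrite inE /f /= => /andP[uU xX] ->; rewrite !inE.
case: (ltngtP u x) => [ux|xu|/val_inj ux] /=.
- by rewrite ux uU xX.
- by rewrite xu uU xX orbT.
- by have := disjointFr dUX uU; rewrite ux xX.
Qed.

Lemma nbhd_disjoint E U : [disjoint U & nbhd E U].
Proof.
rewrite disjoint_sym disjoints_subset; apply/subsetP => v.
by rewrite !inE => /andP[].
Qed.

Lemma nbhd_avoid G S U :
  [disjoint S & cross_pairs U (~: (U :|: nbhd (gunion G S) U))].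
Proof.
apply/pred0P => -[a b] /=; apply/negP => /andP[abS].
rewrite !inE /=.
have key u v : u \in U -> v \notin U -> (u, v) \in S \/ (v, u) \in S ->
    [exists x in U, gadj (gunion G S) x v].
  move=> uU vU h; apply/existsP; exists u; rewrite uU; apply: gadj_unionr.
  rewrite /gadj; case: eqP => [uv|_ /=]; first by rewrite -uv uU in vU.
  by case: h => ->; rewrite ?orbT.
case/andP => _ /orP[/andP[u] | /andP[+ u]]; rewrite negb_or => /andP[v];
  rewrite v /= => /negP; apply.
- by apply: (key a b u v); left.
- by apply: (key b a u v); right.
Qed.

End Separation.

(** * Union bound over separators and traces *)

Section UnionBound.
Local Open Scope ring_scope.

(** [Q] separates the counting from the analysis: it will say that [w] neighbours are too few for a
    set of [k] vertices, and its hypothesis bounds the probability of one such cut. *)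
Lemma sum_small_nbhd_le (K : realFieldType) (n : nat) (G : graph n) (p : K)
    (Q : nat -> nat -> bool) :
  (1 < n)%N -> gconnected G -> 0 <= p -> p <= 1 ->
  (forall k w, Q k w ->
     (1 - p) ^+ (k * (n - k - w)) <= n%:R^-1 ^+ (3 * maxdeg G * w)) ->
  \sum_(S : {set 'I_n * 'I_n} | (S \subset upairs n) &&
      [exists U : {set 'I_n},
        [&& U != set0, U != setT & Q #|U| #|nbhd (gunion G S) U| ]])
     p ^+ #|S| * (1 - p) ^+ (#|upairs n| - #|S|)
  <= (1 + n%:R^-1 ^+ 2) ^+ n - 1.
Proof.
move=> n1 cG p0 p1 hQ; set x : K := n%:R^-1.
have x0 : 0 <= x by rewrite invr_ge0.
have x2 : 2 * x <= 1.
  by rewrite ler_pdivrMr ?mul1r ?ltr0n ?ler_nat ?(ltnW n1).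
have x1 : x <= 1 by apply: le_trans x2; rewrite ler_peMl // ler1n.
have q0 : 0 <= 1 - p by rewrite subr_ge0.
have q1 : 1 - p <= 1 by rewrite gerBl.
have f0 (S : {set 'I_n * 'I_n}) : 0 <= p ^+ #|S| * (1 - p) ^+ (#|upairs n| - #|S|).
  by rewrite mulr_ge0 ?exprn_ge0.
pose C (X : {set 'I_n} * {set 'I_n}) := cut_closure G X.1 X.2.
pose D X := cross_pairs (C X) (~: (C X :|: X.1)).
pose P (W T : {set 'I_n}) :=
  (T \subset nbhd G W) && ([disjoint C (W, T) & W] && Q #|C (W, T)| #|W|).
(* A bad [S] with witness [U] is charged to the neighbourhood of [U] and the trace of [U] next to
   it, from which [cut_closure] recovers [U]. *)
apply: (@le_trans _ _ (\sum_(X : {set 'I_n} * {set 'I_n} | (X.1 != set0) && P X.1 X.2)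
   \sum_(S : {set 'I_n * 'I_n} | (S \subset upairs n) && [disjoint S & D X])
     p ^+ #|S| * (1 - p) ^+ (#|upairs n| - #|S|))).
  apply: sum_union_bound => // S /andP[SA /existsP[U /and3P[U0 UT QU]]].
  set W := nbhd (gunion G S) U in QU *.
  have NW : nbhd G U \subset W by exact: nbhdU.
  have W0 : W != set0.
    have /set0Pn[v /(subsetP NW) vW] := nbhd_neq0 cG U0 UT.
    by apply/set0Pn; exists v.
  have dUW : [disjoint U & W] by exact: nbhd_disjoint.
  have CU : C (W, U :&: nbhd G W) = U by exact: cut_closure_trace.
  exists (W, U :&: nbhd G W); rewrite /P /= ?W0 ?CU ?dUW ?QU ?subsetIr //.
  by rewrite SA /D CU; exact: nbhd_avoid.
rewrite -(pair_big_dep (fun W => W != set0) P (fun W T =>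
  \sum_(S : {set 'I_n * 'I_n} | (S \subset upairs n) && [disjoint S & D (W, T)])
     p ^+ #|S| * (1 - p) ^+ (#|upairs n| - #|S|))) /=.
apply: (@le_trans _ _ (\sum_(W : {set 'I_n} | W != set0) (x ^+ 2) ^+ #|W|)).
  apply: ler_sum => W W0.
  apply: (@le_trans _ _ (\sum_(T : {set 'I_n} | T \subset nbhd G W)
      x ^+ (3 * maxdeg G * #|W|))).
    rewrite /P big_mkcondr; apply: ler_sum => T _.
    case: ifP => [/andP[dCW QC] | _]; last by rewrite exprn_ge0.
    rewrite sum_subset_avoid; last by apply/subsetP => e; rewrite inE => /andP[].
    apply: le_trans _ (hQ _ _ QC); apply: ler_wiXn2l => //.
    apply: leq_trans _ (card_cross_pairs_ge _); last first.
      by rewrite -setI_eq0 setCU setIA setICr set0I.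
    rewrite leq_mul2l; apply/orP; right.
    rewrite [X in (_ <= X)%N]cardsCs setCK card_ord cardsU.
    by move: dCW; rewrite -setI_eq0 => /eqP ->; rewrite cards0 subn0 subnDA.
  rewrite sumr_const.
  have -> : #|[pred T : {set 'I_n} | T \subset nbhd G W]| = (2 ^ #|nbhd G W|)%N.
    by rewrite -card_powerset; apply: eq_card => T; rewrite !inE.
  set m := (maxdeg G * #|W|)%N.
  have Wm : (#|W| <= m)%N by rewrite leq_pmull ?maxdeg_gt0.
  apply: (@le_trans _ _ (x ^+ (2 * m))); last first.
    by rewrite -exprM ler_wiXn2l // leq_mul2l.
  rewrite -mulr_natl natrX -mulnA -/m.
  (* There are at most [2 ^+ m] traces; as [2 * x <= 1], they are absorbed by [m] of the [3 * m]
     factors [x]. *)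
  apply: (@le_trans _ _ (2 ^+ m * x ^+ (3 * m))).
    by rewrite ler_wpM2r ?exprn_ge0 // ler_weXn2l ?ler1n // card_nbhd_le.
  rewrite (_ : (3 * m = m + 2 * m)%N) // exprD mulrA -exprMn.
  by rewrite ler_piMl ?exprn_ge0 // exprn_ile1 // mulr_ge0.
(* Over all [W] the sum is [(1 + x ^+ 2) ^+ n]; the empty set accounts for the subtracted 1. *)
have := sum_subset_exp [set: 'I_n] (x ^+ 2) 1.
rewrite cardsT card_ord [1 + _]addrC => <-.
rewrite [X in _ <= X - _](bigD1 set0) ?sub0set //=.
rewrite cards0 expr0 expr1n mul1r [1 + _]addrC addrK.
rewrite le_eqVlt; apply/orP; left; apply/eqP; apply: eq_big => W.
  by rewrite subsetT.
by rewrite expr1n mulr1.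
Qed.

End UnionBound.

(** * Real estimates and the choice of constants *)

Section RealEstimates.
Local Open Scope R_scope.

Lemma Rdiv_itv01 (x y : R) : 0 < x -> x <= y -> 0 <= x / y <= 1.
Proof.
move=> x0 xy; split; first by apply: Rlt_le; apply: Rdiv_lt_0_compat; lra.
by apply: (Rmult_le_reg_r y); rewrite ?/Rdiv ?Rmult_assoc ?Rinv_l; lra.
Qed.

Lemma exp_mul_INR (a : R) (m : nat) : exp (INR m * a) = exp a ^ m.
Proof.
elim: m => [|m IH]; first by rewrite Rmult_0_l exp_0.
by rewrite S_INR Rmult_plus_distr_r Rmult_1_l exp_plus IH /= Rmult_comm.
Qed.

Lemma exp_mono_le (a b : R) : a <= b -> exp a <= exp b.
Proof. by case=> [/exp_increasing /Rlt_le //|->]; right. Qed.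

(** With [L = ln n], the last hypothesis yields [w D L <= eps k / 12]. Since [L >= eps / 6], this
    forces [w <= k / 2], so [n - k - w >= n / 4] and the left side is at most
    [exp (- eps k / 4) <= exp (- 3 D w L)]. The 12 is the product of this 4 and 3. *)
Lemma cut_term_le (eps : R) (n k w D : nat) :
  0 < eps -> eps <= INR n -> (1 < n)%N -> (0 < D)%N -> eps / 6 <= ln (INR n) ->
  (2 * k <= n)%N ->
  INR w < eps / 12 / (INR D ^ 3 * ln (INR n)) * INR k ->
  (1 - eps / INR n) ^ (k * (n - k - w)) <= (/ INR n) ^ (3 * D * w).
Proof.
move=> e0 en n1 D0 eL kn hw.
have n2 : 2 <= INR n by apply: (le_INR 2); apply/ssrnat.leP.
have D1 : 1 <= INR D by apply: (le_INR 1); apply/ssrnat.leP.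
have w0 := pos_INR w; have k0 := pos_INR k.
have kn' : 2 * INR k <= INR n.
  by rewrite -[2]/(INR 2) -mult_INR; apply: le_INR; apply/ssrnat.leP.
set L := ln (INR n) in eL hw *.
have L0 : 0 < L by lra.
have D2 : 1 <= INR D ^ 2 by apply: pow_R1_Rle.
have DL : INR D * L <= INR D ^ 3 * L.
  rewrite (_ : INR D ^ 3 = INR D ^ 2 * INR D); last by ring.
  by apply: Rmult_le_compat_r; nra.
have L1 : L <= INR D * L by nra.
have hw1 : INR w * (INR D ^ 3 * L) < eps / 12 * INR k.
  have := Rmult_lt_compat_r (INR D ^ 3 * L) _ _ _ hw.
  rewrite (_ : _ * INR k * _ = eps / 12 * INR k); last by field; split; lra.
  by apply; lra.
have hw2 : INR w * (INR D * L) <= eps / 12 * INR k.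
  by apply: Rle_trans (Rlt_le _ _ hw1); apply: Rmult_le_compat_l.
have wk : 2 * INR w <= INR k.
  have : INR w * (eps / 6) <= eps / 12 * INR k.
    by apply: Rle_trans hw2; apply: Rmult_le_compat_l => //; lra.
  by nra.
(* This ensures that the truncated difference [n - k - w] is the true one. *)
have kwn : (k + w <= n)%N.
  by apply/ssrnat.leP/INR_le; rewrite plus_INR; lra.
have m4 : INR n / 4 <= INR (n - k - w).
  by rewrite -subnDA minus_INR ?plus_INR; [lra | apply/ssrnat.leP].
set m := (k * (n - k - w))%N.
have km : INR k * INR n / 4 <= INR m.
  by rewrite mult_INR; nra.
have [p0 p1] : 0 <= eps / INR n <= 1 by apply: Rdiv_itv01.
have -> : / INR n = exp (- L) by rewrite exp_Ropp exp_ln //; lra.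
apply: (Rle_trans _ (exp (- (eps / INR n)) ^ m)).
  by apply: pow_incr; split; [lra | have := exp_ineq1_le (- (eps / INR n)); lra].
rewrite -!exp_mul_INR; apply: exp_mono_le.
have : eps * INR k / 4 <= eps / INR n * INR m.
  rewrite (_ : eps * INR k / 4 = eps / INR n * (INR k * INR n / 4)); last by field; lra.
  by apply: Rmult_le_compat_l; lra.
by rewrite !mult_INR -[INR 3]/(1 + 1 + 1); nra.
Qed.

(** The power is at most [exp (1 / n)], and inverting [exp (- 1 / n) >= 1 - 1 / n] bounds that by
    [n / (n - 1)]. *)
Lemma pow_one_plus_inv_sqr_le (n : nat) : (1 < n)%N ->
  (1 + (/ INR n) ^ 2) ^ n - 1 <= / (INR n - 1).
Proof.
move=> n1; have n2 : 2 <= INR n by apply: (le_INR 2); apply/ssrnat.leP.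
have x2 : 0 <= (/ INR n) ^ 2 by apply: pow2_ge_0.
have h : (1 + (/ INR n) ^ 2) ^ n <= exp (/ INR n).
  apply: (Rle_trans _ (exp ((/ INR n) ^ 2) ^ n)).
    by apply: pow_incr; split; [lra | exact: exp_ineq1_le].
  by rewrite -exp_mul_INR; right; congr exp; field; lra.
have := exp_ineq1_le (- / INR n); rewrite exp_Ropp => h2.
have e0 := exp_pos (/ INR n).
have h3 : exp (/ INR n) * (INR n - 1) <= INR n.
  have : exp (/ INR n) * INR n * (1 + - / INR n) <=
    exp (/ INR n) * INR n * / exp (/ INR n).
    by apply: Rmult_le_compat_l => //; nra.
  rewrite (_ : _ * INR n * / _ = INR n); last by field; lra.
  by rewrite (_ : _ * (1 + _) = exp (/ INR n) * (INR n - 1)) //; field; lra.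
suff : exp (/ INR n) <= 1 + / (INR n - 1) by lra.
apply: (Rmult_le_reg_r (INR n - 1)); first lra.
by rewrite Rmult_plus_distr_r Rinv_l; lra.
Qed.

(** The hypothesis [t <= INR n] covers the initial value of the [Rmin] fold. *)
Lemma vert_iso_ge (n : nat) (E : graph n) (t : R) : t <= INR n ->
  (forall U : {set 'I_n}, (0 < #|U|)%N -> (2 * #|U| <= n)%N ->
     t * INR #|U| <= INR #|nbhd E U|) ->
  t <= vert_iso E.
Proof.
move=> tn h; rewrite /vert_iso; elim/big_ind: _ => // [x y|U /andP[U0 U2]].
  exact: Rmin_glb.
have u0 : 0 < INR #|U| by apply: (lt_INR 0); apply/ssrnat.ltP.
apply: (Rmult_le_reg_r (INR #|U|)) => //.
by rewrite /Rdiv Rmult_assoc Rinv_l; [rewrite Rmult_1_r; exact: h | lra].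
Qed.

End RealEstimates.

(** * Probability of a small isoperimetric number and its limit *)

Section Convergence.
Local Open Scope R_scope.

Lemma RlebP (x y : R) : reflect (x <= y) (Rleb x y).
Proof. by rewrite /Rleb; case: Rle_dec => h; constructor. Qed.

Lemma gnp_probE (n : nat) (p : R) (A : graph n -> bool) :
  gnp_prob p A = (\sum_(S : {set 'I_n * 'I_n} | (S \subset upairs n) && A S)
     p ^+ #|S| * (1 - p) ^+ (#|upairs n| - #|S|))%R.
Proof. by rewrite /gnp_prob; apply: eq_bigr => S _; rewrite !RpowE. Qed.

Lemma gnp_probC (n : nat) (p : R) (A : graph n -> bool) :
  gnp_prob p A = 1 - gnp_prob p (fun S => ~~ A S).
Proof.
have := sum_subset_exp (upairs n) p (1 - p)%R.
rewrite [(p + _)%R]addrC subrK expr1n (bigID A) /= -!gnp_probE => h.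
have {}h : gnp_prob p A + gnp_prob p (fun S => ~~ A S) = 1 := h.
by lra.
Qed.

Lemma gnp_prob_le (n : nat) (p : R) (A B : graph n -> bool) :
  0 <= p <= 1 -> (forall S, A S -> B S) -> gnp_prob p A <= gnp_prob p B.
Proof.
move=> [/RleP p0 /RleP p1] AB; apply/RleP; rewrite !gnp_probE.
have f0 (S : {set 'I_n * 'I_n}) : (0 <= p ^+ #|S| * (1 - p) ^+ (#|upairs n| - #|S|))%R.
  by rewrite mulr_ge0 ?exprn_ge0 // subr_ge0.
rewrite big_mkcond [leRHS]big_mkcond /=; apply: ler_sum => S _.
case: (S \subset _) => //=; case: ifP => [/AB ->|] //; by case: ifP.
Qed.

Lemma gnp_prob_ge0 (n : nat) (p : R) (A : graph n -> bool) :
  0 <= p <= 1 -> 0 <= gnp_prob p A.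
Proof.
move=> hp; have := @gnp_prob_le n p (fun=> false) A hp (fun _ => ltac:(done)).
by rewrite /gnp_prob big_pred0 // => S; rewrite andbF.
Qed.

Lemma small_vert_iso_prob_le (eps : R) (n : nat) (G : graph n) :
  0 < eps -> eps <= INR n -> (1 < n)%N -> eps / 6 <= ln (INR n) -> gconnected G ->
  gnp_prob (eps / INR n)
    (fun S => ~~ Rleb (eps / 12 / (INR (maxdeg G) ^ 3 * ln (INR n)))
                      (vert_iso (gunion G S))) <= / (INR n - 1).
Proof.
move=> e0 en n1 eL cG; set t := eps / 12 / _.
have D0 := maxdeg_gt0 n1 cG.
have n2 : 2 <= INR n by apply: (le_INR 2); apply/ssrnat.leP.
have D1 : 1 <= INR (maxdeg G) by apply: (le_INR 1); apply/ssrnat.leP.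
have D3 : 1 <= INR (maxdeg G) ^ 3 by apply: pow_R1_Rle.
have hp : 0 <= eps / INR n <= 1 by apply: Rdiv_itv01; lra.
(* From [eps / 6 <= ln n] and [maxdeg G >= 1], [t] is in fact at most 1/2. *)
have tn : t <= INR n.
  apply: (Rmult_le_reg_r (INR (maxdeg G) ^ 3 * ln (INR n))); first by nra.
  rewrite /t /Rdiv Rmult_assoc Rinv_l; last by nra.
  have : ln (INR n) <= INR (maxdeg G) ^ 3 * ln (INR n) by nra.
  by nra.
pose Q k w := (2 * k <= n)%N && ~~ Rleb (t * INR k) (INR w).
apply: Rle_trans (pow_one_plus_inv_sqr_le n1).
apply: (Rle_trans _ (gnp_prob (eps / INR n) (fun S => [exists U : {set 'I_n},
        [&& U != set0, U != setT & Q #|U| #|nbhd (gunion G S) U| ]]))).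
  apply: gnp_prob_le => // S; apply: contraNT => /existsPn h.
  apply/RlebP; apply: vert_iso_ge => // U U0 U2; apply/RlebP.
  (* The size bound [2 * #|U| <= n] rules out [U = setT], because [n] is positive. *)
  have := h U; rewrite -card_gt0 U0 /Q U2 /= negb_and !negbK => /orP[/eqP UT|//].
  move: U2; rewrite UT cardsT card_ord mul2n -addnn.
  by rewrite -[X in (_ <= X)%N]addn0 leq_add2l leqNgt (ltnW n1).
apply/RleP; rewrite gnp_probE RminusE RplusE !RpowE RinvE INRE.
move: hp; rewrite INRE => -[/RleP p0 /RleP p1].
apply: sum_small_nbhd_le => // k w /andP[kn /RlebP/Rnot_le_lt hw].
by apply/RleP; have := cut_term_le e0 en n1 D0 eL kn hw; rewrite !RpowE RinvE -!INRE.
Qed.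

End Convergence.

Theorem theorem1 :
  forall eps : R, Rlt R0 eps ->
  exists delta : R, Rlt R0 delta /\
  forall G : forall n : nat, graph n,
    (forall n : nat, gconnected (G n)) ->
    Un_cv
      (fun n : nat =>
         gnp_prob (Rdiv eps (INR n))
           (fun S : graph n =>
              Rleb (Rdiv delta (Rmult (pow (INR (maxdeg (G n))) 3) (ln (INR n))))
                   (vert_iso (gunion (G n) S))))
      R1.
Proof.
Local Open Scope R_scope.
move=> eps e0; exists (eps / 12); split; first lra.
move=> G cG a a0.
(* The summands secure, in order, [eps / n <= 1], [eps / 6 <= ln n], [1 / (n - 1) < a] (together
   with the final 1), and [1 < n]. *)
have [N hN] := INR_unbounded (eps + exp (eps / 6) + / a + 1).
exists N => n /le_INR Nn.
have ex0 := exp_pos (eps / 6); have ia0 := Rinv_0_lt_compat _ a0.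
have n1 : (1 < n)%N by apply/ssrnat.ltP/INR_lt; change (1 < INR n); lra.
have eL : eps / 6 <= ln (INR n).
  by rewrite -[X in X <= _]ln_exp; apply: Rlt_le; apply: ln_increasing; lra.
have hp : 0 <= eps / INR n <= 1 by apply: Rdiv_itv01; lra.
have en : eps <= INR n by lra.
have hb := small_vert_iso_prob_le e0 en n1 eL (cG n).
have hb0 := gnp_prob_ge0 (fun S =>
  ~~ Rleb (eps / 12 / (INR (maxdeg (G n)) ^ 3 * ln (INR n)))
          (vert_iso (gunion (G n) S))) hp.
have hi : / (INR n - 1) < a.
  by rewrite -[a]Rinv_inv; apply: Rinv_lt_contravar; [apply: Rmult_lt_0_compat|]; lra.
rewrite gnp_probC /Rdist; apply: Rabs_def1; lra.
Qed.
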